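(* We have $$\int_0^1\arctan\Bigl(\frac{\operatorname{arctanh} x-\arctan x}{\pi+\operatorname{arctanh} x-\arctan x}\Bigr)\frac{dx}{x}= \frac{\pi}{8}\log\frac{\pi^2}{8}.$$
   Context: For real $-1<x<1$, $\operatorname{arctanh} x=\int_0^x \frac{dt}{1-t^2}$ and $\arctan x=\int_0^x\frac{dt}{1+t^2}$. The outer $\arctan$ is the usual real arctangent with values in $(-\pi/2,\pi/2)$, and $\log$ is the natural logarithm. *)

(* Defs.v *)
From Stdlib Require Import Reals.
From Coquelicot Require Import Coquelicot.

Open Scope R_scope.

(** Meaningful for [-1 < x < 1] only: outside this interval the integrand has a
    non-integrable singularity between [0] and [x], and [RInt] is unspecified. *)
Definition arctanh (x : R) : R := RInt (fun t => 1 / (1 - t ^ 2)) 0 x.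

(* Main.v *)
(** Let [h = arctanh z + arctan z] and [N = PI + (1 + i) (arctanh z - arctan z)].
    Then [F = log (N z / h)] is analytic in the sector [0 < arg z < PI / 4],
    [|z| < 1].  On the real axis its imaginary part is the arctangent in the
    integrand, and on the ray [arg z = PI / 4] it is real.  By the Cauchy-Riemann
    equations the integral [K r] of [Re F] over the arc [|z| = r] satisfies
    [K' r = (Im F (r e^(i PI/4)) - Im F r) / r], so the integral is
    [K 0 - K 1].  At [0], [N z / h] tends to [PI / 2]; on the arc [|z| = 1] one
    has [|N| = sqrt 2 |h|] identically, although both blow up at [z = 1]. *)

Require Import Defs.
From Stdlib Require Import Reals Lra.
From Coquelicot Require Import Coquelicot.

Open Scope R_scope.

(** * Real and imaginary parts of [arctanh z] and [arctan z] in polar coordinates *)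

(** With [z = r e^(it)]: [P r (cos t)] and [Q r (sin t)] are the real and
    imaginary parts of [arctanh z], while [Q r (cos t)] and [P r (sin t)] are
    those of [arctan z]. *)
Definition P (r c : R) : R :=
  / 4 * ln ((1 + r ^ 2 + 2 * r * c) / (1 + r ^ 2 - 2 * r * c)).
Definition Q (r c : R) : R := / 2 * atan (2 * r * c / (1 - r ^ 2)).

Definition P_r (r c : R) : R :=
  c * (1 - r ^ 2) / ((1 + r ^ 2) ^ 2 - 4 * r ^ 2 * c ^ 2).
Definition P_c (r c : R) : R :=
  r * (1 + r ^ 2) / ((1 + r ^ 2) ^ 2 - 4 * r ^ 2 * c ^ 2).
Definition Q_r (r c : R) : R :=
  c * (1 + r ^ 2) / ((1 - r ^ 2) ^ 2 + 4 * r ^ 2 * c ^ 2).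
Definition Q_c (r c : R) : R :=
  r * (1 - r ^ 2) / ((1 - r ^ 2) ^ 2 + 4 * r ^ 2 * c ^ 2).

Lemma P_num_pos (r c : R) : 0 <= r < 1 -> -1 <= c <= 1 -> 0 < 1 + r ^ 2 + 2 * r * c.
Proof. intros; nra. Qed.

Lemma P_den_pos (r c : R) : 0 <= r < 1 -> -1 <= c <= 1 -> 0 < 1 + r ^ 2 - 2 * r * c.
Proof. intros; nra. Qed.

Lemma one_minus_sqr_pos (r : R) : 0 <= r < 1 -> 0 < 1 - r ^ 2.
Proof. intros; nra. Qed.

Lemma P_r_den_pos (r c : R) :
  0 <= r < 1 -> -1 <= c <= 1 -> 0 < (1 + r ^ 2) ^ 2 - 4 * r ^ 2 * c ^ 2.
Proof.
  intros Hr Hc.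
  replace (_ - _) with ((1 + r ^ 2 + 2 * r * c) * (1 + r ^ 2 - 2 * r * c)) by ring.
  apply Rmult_lt_0_compat; [apply P_num_pos | apply P_den_pos]; assumption.
Qed.

Lemma Q_r_den_pos (r c : R) : 0 <= r < 1 -> 0 < (1 - r ^ 2) ^ 2 + 4 * r ^ 2 * c ^ 2.
Proof.
  intros Hr. pose proof (one_minus_sqr_pos r Hr).
  assert (0 <= (r * c) ^ 2) by apply pow2_ge_0.
  replace (4 * r ^ 2 * c ^ 2) with (4 * (r * c) ^ 2) by ring.
  nra.
Qed.

(** Both arguments may vary with [x], so one chain rule serves the radial derivative ([c] constant)
    and the angular one ([r] constant, [c] a cosine or sine). *)
Lemma is_derive_P (r c : R -> R) (x dr dc : R) :
  0 <= r x < 1 -> -1 <= c x <= 1 -> is_derive r x dr -> is_derive c x dc ->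
  is_derive (fun x => P (r x) (c x)) x (dr * P_r (r x) (c x) + dc * P_c (r x) (c x)).
Proof.
  intros Hr Hc Dr Dc.
  pose proof (P_num_pos _ _ Hr Hc) as H1. pose proof (P_den_pos _ _ Hr Hc) as H2.
  pose proof (P_r_den_pos _ _ Hr Hc) as H3.
  unfold P, P_r, P_c. auto_derive.
  - repeat split; try (eexists; eassumption); try lra.
    apply Rdiv_lt_0_compat; lra.
  - replace (Derive (fun x0 : R => r x0) x) with dr by (symmetry; apply is_derive_unique, Dr).
    replace (Derive (fun x0 : R => c x0) x) with dc by (symmetry; apply is_derive_unique, Dc).
    field. simpl in *. repeat split; lra.
Qed.

Lemma is_derive_Q (r c : R -> R) (x dr dc : R) :
  0 <= r x < 1 -> is_derive r x dr -> is_derive c x dc ->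
  is_derive (fun x => Q (r x) (c x)) x (dr * Q_r (r x) (c x) + dc * Q_c (r x) (c x)).
Proof.
  intros Hr Dr Dc.
  pose proof (one_minus_sqr_pos _ Hr) as H1.
  pose proof (Q_r_den_pos _ (c x) Hr) as H3.
  unfold Q, Q_r, Q_c. auto_derive.
  - repeat split; try (eexists; eassumption); lra.
  - replace (Derive (fun x0 : R => r x0) x) with dr by (symmetry; apply is_derive_unique, Dr).
    replace (Derive (fun x0 : R => c x0) x) with dc by (symmetry; apply is_derive_unique, Dc).
    field. simpl in *. repeat split; lra.
Qed.

(** * The functions [h] and [N] and their Cauchy-Riemann equations *)

(** [arctanh z + arctan z = A + i B] and
    [PI + (1 + i) (arctanh z - arctan z) = U + i V]. *)
Definition A (r t : R) : R := P r (cos t) + Q r (cos t).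
Definition B (r t : R) : R := P r (sin t) + Q r (sin t).
Definition U (r t : R) : R :=
  PI + (P r (cos t) - Q r (cos t)) + (P r (sin t) - Q r (sin t)).
Definition V (r t : R) : R :=
  (P r (cos t) - Q r (cos t)) - (P r (sin t) - Q r (sin t)).

Definition A_r (r t : R) : R := P_r r (cos t) + Q_r r (cos t).
Definition B_r (r t : R) : R := P_r r (sin t) + Q_r r (sin t).
Definition U_r (r t : R) : R :=
  (P_r r (cos t) - Q_r r (cos t)) + (P_r r (sin t) - Q_r r (sin t)).
Definition V_r (r t : R) : R :=
  (P_r r (cos t) - Q_r r (cos t)) - (P_r r (sin t) - Q_r r (sin t)).

(** Both sides are [|1 - z^2|^2] for [z = r e^(it)]; in the sine version below they are
    [|1 + z^2|^2]. These common denominators make the Cauchy-Riemann equations match. *)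
Lemma P_r_den_cos (r t : R) :
  (1 + r ^ 2) ^ 2 - 4 * r ^ 2 * cos t ^ 2 = (1 - r ^ 2) ^ 2 + 4 * r ^ 2 * sin t ^ 2.
Proof.
  pose proof (sin2_cos2 t) as E. unfold Rsqr in E.
  replace (sin t ^ 2) with (1 - cos t ^ 2) by lra. ring.
Qed.

Lemma P_r_den_sin (r t : R) :
  (1 + r ^ 2) ^ 2 - 4 * r ^ 2 * sin t ^ 2 = (1 - r ^ 2) ^ 2 + 4 * r ^ 2 * cos t ^ 2.
Proof.
  pose proof (sin2_cos2 t) as E. unfold Rsqr in E.
  replace (sin t ^ 2) with (1 - cos t ^ 2) by lra. ring.
Qed.

Section Derivatives.
Variables r t : R.
Hypothesis Hr : 0 <= r < 1.

Lemma is_derive_P_r (c : R) : -1 <= c <= 1 -> is_derive (fun r => P r c) r (P_r r c).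
Proof.
  intros Hc.
  replace (P_r r c) with (1 * P_r r c + 0 * P_c r c) by ring.
  exact (is_derive_P (fun r => r) (fun _ => c) r 1 0 Hr Hc (is_derive_id r) (is_derive_const c r)).
Qed.

Lemma is_derive_Q_r (c : R) : is_derive (fun r => Q r c) r (Q_r r c).
Proof.
  replace (Q_r r c) with (1 * Q_r r c + 0 * Q_c r c) by ring.
  exact (is_derive_Q (fun r => r) (fun _ => c) r 1 0 Hr (is_derive_id r) (is_derive_const c r)).
Qed.

(** This and the next three lemmas are the polar equations [u_t = - r v_r], [v_t = r u_r] for
    [arctanh z] ([u] is [P] at the cosine, [v] is [Q] at the sine) and for [arctan z] (with [P] and
    [Q] exchanged). *)
Lemma is_derive_P_cos :
  is_derive (fun t => P r (cos t)) t (- r * Q_r r (sin t)).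
Proof.
  evar_last.
  { apply (is_derive_P (fun _ => r) cos t 0 (- sin t) Hr (COS_bound t) (is_derive_const r t)).
    auto_derive; [exact I | ring]. }
  pose proof (P_r_den_pos r (cos t) Hr (COS_bound t)). pose proof (Q_r_den_pos r (sin t) Hr).
  unfold P_r, P_c, Q_r. rewrite P_r_den_cos. field. lra.
Qed.

Lemma is_derive_P_sin :
  is_derive (fun t => P r (sin t)) t (r * Q_r r (cos t)).
Proof.
  evar_last.
  { apply (is_derive_P (fun _ => r) sin t 0 (cos t) Hr (SIN_bound t) (is_derive_const r t)).
    auto_derive; [exact I | ring]. }
  pose proof (P_r_den_pos r (sin t) Hr (SIN_bound t)). pose proof (Q_r_den_pos r (cos t) Hr).
  unfold P_r, P_c, Q_r. rewrite P_r_den_sin. field. lra.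
Qed.

Lemma is_derive_Q_cos :
  is_derive (fun t => Q r (cos t)) t (- r * P_r r (sin t)).
Proof.
  evar_last.
  { apply (is_derive_Q (fun _ => r) cos t 0 (- sin t) Hr (is_derive_const r t)).
    auto_derive; [exact I | ring]. }
  pose proof (P_r_den_pos r (sin t) Hr (SIN_bound t)). pose proof (Q_r_den_pos r (cos t) Hr).
  unfold P_r, Q_c, Q_r. rewrite P_r_den_sin. field. lra.
Qed.

Lemma is_derive_Q_sin :
  is_derive (fun t => Q r (sin t)) t (r * P_r r (cos t)).
Proof.
  evar_last.
  { apply (is_derive_Q (fun _ => r) sin t 0 (cos t) Hr (is_derive_const r t)).
    auto_derive; [exact I | ring]. }
  pose proof (P_r_den_pos r (cos t) Hr (COS_bound t)). pose proof (Q_r_den_pos r (sin t) Hr).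
  unfold P_r, Q_c, Q_r. rewrite P_r_den_cos. field. lra.
Qed.

Lemma is_derive_A_r : is_derive (fun r => A r t) r (A_r r t).
Proof.
  apply (is_derive_plus (V := R_NormedModule)); [apply is_derive_P_r, COS_bound | apply is_derive_Q_r].
Qed.

Lemma is_derive_B_r : is_derive (fun r => B r t) r (B_r r t).
Proof.
  apply (is_derive_plus (V := R_NormedModule)); [apply is_derive_P_r, SIN_bound | apply is_derive_Q_r].
Qed.

Lemma is_derive_U_r : is_derive (fun r => U r t) r (U_r r t).
Proof.
  pose proof (is_derive_P_r _ (COS_bound t)). pose proof (is_derive_P_r _ (SIN_bound t)).
  pose proof (is_derive_Q_r (cos t)). pose proof (is_derive_Q_r (sin t)).
  evar_last.
  { apply (is_derive_plus (V := R_NormedModule) (fun r => PI + (P r (cos t) - Q r (cos t)))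
      (fun r => P r (sin t) - Q r (sin t))).
    - apply (is_derive_plus (V := R_NormedModule) (fun _ => PI)).
      + apply @is_derive_const.
      + apply @is_derive_minus; eassumption.
    - apply @is_derive_minus; eassumption. }
  unfold U_r, plus, minus, opp, zero; simpl; unfold plus, opp; simpl. ring.
Qed.

Lemma is_derive_V_r : is_derive (fun r => V r t) r (V_r r t).
Proof.
  pose proof (is_derive_P_r _ (COS_bound t)). pose proof (is_derive_P_r _ (SIN_bound t)).
  pose proof (is_derive_Q_r (cos t)). pose proof (is_derive_Q_r (sin t)).
  apply @is_derive_minus; apply @is_derive_minus; assumption.
Qed.

(** Polar Cauchy-Riemann equations: the [t]-derivatives in terms of the
    [r]-derivatives. *)
Lemma is_derive_A_t : is_derive (fun t => A r t) t (- r * B_r r t).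
Proof.
  evar_last.
  { apply (is_derive_plus (V := R_NormedModule)); [apply is_derive_P_cos | apply is_derive_Q_cos]. }
  unfold B_r, plus; simpl. ring.
Qed.

Lemma is_derive_B_t : is_derive (fun t => B r t) t (r * A_r r t).
Proof.
  evar_last.
  { apply (is_derive_plus (V := R_NormedModule)); [apply is_derive_P_sin | apply is_derive_Q_sin]. }
  unfold A_r, plus; simpl. ring.
Qed.

Lemma is_derive_U_t : is_derive (fun t => U r t) t (- r * V_r r t).
Proof.
  evar_last.
  { apply (is_derive_plus (V := R_NormedModule) (fun t => PI + (P r (cos t) - Q r (cos t)))
      (fun t => P r (sin t) - Q r (sin t))).
    - apply (is_derive_plus (V := R_NormedModule) (fun _ => PI)).
      + apply @is_derive_const.
      + apply @is_derive_minus; [apply is_derive_P_cos | apply is_derive_Q_cos].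
    - apply @is_derive_minus; [apply is_derive_P_sin | apply is_derive_Q_sin]. }
  unfold V_r, plus, minus, opp, zero; simpl; unfold plus, opp; simpl. ring.
Qed.

Lemma is_derive_V_t : is_derive (fun t => V r t) t (r * U_r r t).
Proof.
  evar_last.
  { apply @is_derive_minus; apply @is_derive_minus;
      [apply is_derive_P_cos | apply is_derive_Q_cos | apply is_derive_P_sin | apply is_derive_Q_sin]. }
  unfold U_r, plus, minus, opp, zero; simpl; unfold plus, opp; simpl. ring.
Qed.

End Derivatives.

(** * The logarithm [F = L + i Th] and its derivatives *)

(** [L + i Th] is the logarithm of [(U + i V) z / (A + i B)]. *)
Definition L (r t : R) : R :=
  / 2 * ln (U r t ^ 2 + V r t ^ 2) + ln r - / 2 * ln (A r t ^ 2 + B r t ^ 2).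
Definition Th (r t : R) : R := atan (V r t / U r t) + t - atan (B r t / A r t).
Definition L_r (r t : R) : R :=
  (U r t * U_r r t + V r t * V_r r t) / (U r t ^ 2 + V r t ^ 2) + / r
  - (A r t * A_r r t + B r t * B_r r t) / (A r t ^ 2 + B r t ^ 2).

Lemma sum_sq_pos (x y : R) : x <> 0 -> 0 < x ^ 2 + y ^ 2.
Proof. intros Hx. pose proof (pow2_gt_0 x Hx). pose proof (pow2_ge_0 y). lra. Qed.

Lemma is_derive_L_r (r t : R) :
  0 < r < 1 -> A r t <> 0 -> U r t <> 0 -> is_derive (fun r => L r t) r (L_r r t).
Proof.
  intros Hr HA HU.
  pose proof (sum_sq_pos _ (B r t) HA) as H1. pose proof (sum_sq_pos _ (V r t) HU) as H2.
  assert (Hr' : 0 <= r < 1) by lra.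
  pose proof (is_derive_A_r r t Hr') as DA. pose proof (is_derive_B_r r t Hr') as DB.
  pose proof (is_derive_U_r r t Hr') as DU. pose proof (is_derive_V_r r t Hr') as DV.
  unfold L, L_r. auto_derive.
  - repeat split; try (eexists; eassumption); lra.
  - replace (Derive (fun x0 : R => A x0 t) r) with (A_r r t) by (symmetry; apply is_derive_unique, DA).
    replace (Derive (fun x0 : R => B x0 t) r) with (B_r r t) by (symmetry; apply is_derive_unique, DB).
    replace (Derive (fun x0 : R => U x0 t) r) with (U_r r t) by (symmetry; apply is_derive_unique, DU).
    replace (Derive (fun x0 : R => V x0 t) r) with (V_r r t) by (symmetry; apply is_derive_unique, DV).
    field. repeat split; lra.
Qed.

(** The Cauchy-Riemann equation for [F]: it makes [r * L_r] an exact derivative along the arc, so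
    that its integral reduces to boundary values of [Th]. *)
Lemma is_derive_Th_t (r t : R) :
  0 < r < 1 -> A r t <> 0 -> U r t <> 0 -> is_derive (fun t => Th r t) t (r * L_r r t).
Proof.
  intros Hr HA HU.
  pose proof (sum_sq_pos _ (B r t) HA) as H1. pose proof (sum_sq_pos _ (V r t) HU) as H2.
  assert (Hr' : 0 <= r < 1) by lra.
  pose proof (is_derive_A_t r t Hr') as DA. pose proof (is_derive_B_t r t Hr') as DB.
  pose proof (is_derive_U_t r t Hr') as DU. pose proof (is_derive_V_t r t Hr') as DV.
  unfold Th, L_r. auto_derive.
  - repeat split; try (eexists; eassumption); assumption.
  - replace (Derive (fun x0 : R => A r x0) t) with (- r * B_r r t) by (symmetry; apply is_derive_unique, DA).
    replace (Derive (fun x0 : R => B r x0) t) with (r * A_r r t) by (symmetry; apply is_derive_unique, DB).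
    replace (Derive (fun x0 : R => U r x0) t) with (- r * V_r r t) by (symmetry; apply is_derive_unique, DU).
    replace (Derive (fun x0 : R => V r x0) t) with (r * U_r r t) by (symmetry; apply is_derive_unique, DV).
    field. repeat split; try assumption; lra.
Qed.

(** * Positivity of the real parts of [h] and [N] on the sector *)

(** The cosine bound is [cos (PI / 3)], as [PI / 4 < PI / 3]; through the mean value theorem it also
    yields [t / 2 <= sin t], which later controls the region near [z = 1]. *)
Lemma sector_trig (t : R) :
  0 <= t <= PI / 4 -> / 2 <= cos t <= 1 /\ 0 <= sin t <= 1 /\ sin t <= cos t /\ t / 2 <= sin t.
Proof.
  intros Ht. pose proof PI_RGT_0.
  assert (Hc : forall s, 0 <= s <= PI / 4 -> / 2 <= cos s).
  { intros s Hs. rewrite <- Rdiv_1_l, <- cos_PI3. apply cos_decr_1; lra. }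
  assert (Hsc : sin t <= cos t).
  { rewrite <- sin_shift.
    apply sin_incr_1; lra. }
  pose proof (COS_bound t). pose proof (SIN_bound t).
  assert (0 <= sin t) by (apply sin_ge_0; lra).
  repeat split; try lra; try (apply Hc; lra).
  destruct (MVT_gen sin 0 t cos) as [s [Hs E]].
  - intros; auto_derive; [exact I | ring].
  - intros; apply continuity_sin.
  - rewrite Rmin_left, Rmax_right in Hs by lra.
    rewrite sin_0 in E. pose proof (Hc s ltac:(lra)). nra.
Qed.

Lemma P_nonneg (r c : R) : 0 <= r < 1 -> 0 <= c <= 1 -> 0 <= P r c.
Proof.
  intros Hr Hc. unfold P.
  assert (H2 := P_den_pos r c Hr ltac:(lra)).
  apply Rmult_le_pos; [lra|]. rewrite <- ln_1. apply ln_le; [lra|].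
  apply Rle_div_r; nra.
Qed.

Lemma Q_pos (r c : R) : 0 < r < 1 -> 0 < c -> 0 < Q r c.
Proof.
  intros Hr Hc. unfold Q. pose proof (one_minus_sqr_pos r ltac:(lra)).
  apply Rmult_lt_0_compat; [lra|]. rewrite <- atan_0.
  apply atan_increasing, Rdiv_lt_0_compat; nra.
Qed.

Lemma Q_lt (r c : R) : Q r c < PI / 4.
Proof. unfold Q. pose proof (atan_bound (2 * r * c / (1 - r ^ 2))). lra. Qed.

(** Keeps [h] in the right half-plane, where [atan (B / A)] is a genuine argument. *)
Lemma A_pos (r t : R) : 0 < r < 1 -> 0 <= t <= PI / 4 -> 0 < A r t.
Proof.
  intros Hr Ht. destruct (sector_trig t Ht) as (Hc & Hs & _).
  pose proof (P_nonneg r (cos t)). pose proof (Q_pos r (cos t)). unfold A. lra.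
Qed.

(** The [P] terms are nonnegative and the two subtracted [Q] terms are each below [PI / 4], so at
    most half of the summand [PI] is lost. *)
Lemma U_pos (r t : R) : 0 <= r < 1 -> 0 <= t <= PI / 4 -> 0 < U r t.
Proof.
  intros Hr Ht. destruct (sector_trig t Ht) as (Hc & Hs & _).
  pose proof (P_nonneg r (cos t)). pose proof (P_nonneg r (sin t)).
  pose proof (Q_lt r (cos t)). pose proof (Q_lt r (sin t)).
  pose proof PI_RGT_0. unfold U. lra.
Qed.

(** * Joint continuity, for differentiating under the integral sign *)

Lemma continuity_2d_pt_sqr (f : R -> R -> R) (x y : R) :
  continuity_2d_pt f x y -> continuity_2d_pt (fun u v => f u v ^ 2) x y.
Proof.
  intros Hf. apply (continuity_2d_pt_ext (fun u v => f u v * f u v)).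
  - intros; ring.
  - now apply continuity_2d_pt_mult.
Qed.

Ltac continuity_2d :=
  unfold Rdiv;
  repeat first
    [ eassumption
    | apply continuity_2d_pt_const
    | apply continuity_2d_pt_id1
    | apply continuity_2d_pt_id2
    | apply continuity_2d_pt_plus
    | apply continuity_2d_pt_opp
    | apply continuity_2d_pt_mult
    | apply continuity_2d_pt_sqr
    | apply continuity_2d_pt_inv ].

Section Continuity.
Variables (x y : R) (c : R -> R).
Hypothesis Hx : 0 <= x < 1.
Hypothesis Hc : -1 <= c y <= 1.
Hypothesis Cc : continuity_2d_pt (fun _ v => c v) x y.

Lemma continuity_2d_P : continuity_2d_pt (fun u v => P u (c v)) x y.
Proof.
  pose proof (P_num_pos _ _ Hx Hc). pose proof (P_den_pos _ _ Hx Hc).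
  apply continuity_2d_pt_mult; [apply continuity_2d_pt_const|].
  apply (continuity_1d_2d_pt_comp ln).
  - apply continuity_pt_filterlim, continuous_ln, Rdiv_lt_0_compat; assumption.
  - continuity_2d. lra.
Qed.

Lemma continuity_2d_Q : continuity_2d_pt (fun u v => Q u (c v)) x y.
Proof.
  pose proof (one_minus_sqr_pos _ Hx).
  apply continuity_2d_pt_mult; [apply continuity_2d_pt_const|].
  apply (continuity_1d_2d_pt_comp atan).
  - apply derivable_continuous_pt, derivable_pt_atan.
  - continuity_2d. lra.
Qed.

Lemma continuity_2d_P_r : continuity_2d_pt (fun u v => P_r u (c v)) x y.
Proof.
  pose proof (P_r_den_pos _ _ Hx Hc). unfold P_r. continuity_2d. lra.
Qed.

Lemma continuity_2d_Q_r : continuity_2d_pt (fun u v => Q_r u (c v)) x y.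
Proof.
  pose proof (Q_r_den_pos _ (c y) Hx). unfold Q_r. continuity_2d. lra.
Qed.
End Continuity.

Lemma continuity_2d_cos (x y : R) : continuity_2d_pt (fun _ v => cos v) x y.
Proof. apply (continuity_1d_2d_pt_comp cos); [apply continuity_cos | apply continuity_2d_pt_id2]. Qed.

Lemma continuity_2d_sin (x y : R) : continuity_2d_pt (fun _ v => sin v) x y.
Proof. apply (continuity_1d_2d_pt_comp sin); [apply continuity_sin | apply continuity_2d_pt_id2]. Qed.

Ltac continuity_2d_PQ :=
  repeat first
    [ apply continuity_2d_pt_const
    | apply continuity_2d_pt_plus
    | apply continuity_2d_pt_opp
    | apply continuity_2d_P
    | apply continuity_2d_Q
    | apply continuity_2d_P_r
    | apply continuity_2d_Q_r
    | apply continuity_2d_cos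
    | apply continuity_2d_sin
    | apply COS_bound | apply SIN_bound | assumption ].

Lemma continuity_2d_A (x y : R) : 0 <= x < 1 -> continuity_2d_pt A x y.
Proof. intros; unfold A; continuity_2d_PQ. Qed.

Lemma continuity_2d_U (x y : R) : 0 <= x < 1 -> continuity_2d_pt U x y.
Proof. intros; unfold U; continuity_2d_PQ. Qed.

Lemma continuity_2d_L_r (x y : R) :
  0 < x < 1 -> A x y <> 0 -> U x y <> 0 -> continuity_2d_pt L_r x y.
Proof.
  intros Hx HA HU. assert (Hx' : 0 <= x < 1) by lra.
  pose proof (sum_sq_pos _ (B x y) HA) as H1. pose proof (sum_sq_pos _ (V x y) HU) as H2.
  pose proof (continuity_2d_A x y Hx'). pose proof (continuity_2d_U x y Hx').
  assert (continuity_2d_pt B x y) by (unfold B; continuity_2d_PQ).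
  assert (continuity_2d_pt V x y) by (unfold V; continuity_2d_PQ).
  assert (continuity_2d_pt A_r x y) by (unfold A_r; continuity_2d_PQ).
  assert (continuity_2d_pt B_r x y) by (unfold B_r; continuity_2d_PQ).
  assert (continuity_2d_pt U_r x y) by (unfold U_r; continuity_2d_PQ).
  assert (continuity_2d_pt V_r x y) by (unfold V_r; continuity_2d_PQ).
  unfold L_r. continuity_2d; lra.
Qed.

Lemma continuity_2d_pt_continuous_r (f : R -> R -> R) (x y : R) :
  continuity_2d_pt f x y -> continuous (f x) y.
Proof.
  intros Hf. apply continuity_pt_filterlim. intros eps He.
  destruct (Hf (mkposreal eps He)) as [d Hd]. exists d. split; [apply cond_pos|].
  intros v [_ Hv]. apply Hd; [rewrite Rminus_diag, Rabs_R0; apply cond_pos | exact Hv].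
Qed.

(** * The arc integral [K] and its derivative *)

Lemma locally_unit_interval (r : R) : 0 < r < 1 -> locally r (fun x => 0 < x < 1).
Proof.
  intros Hr. apply (open_and _ _ (open_gt 0) (open_lt 1)). exact Hr.
Qed.

Lemma ex_RInt_L (r : R) : 0 < r < 1 -> ex_RInt (fun t => L r t) 0 (PI / 4).
Proof.
  intros Hr. pose proof PI_RGT_0. apply (ex_RInt_continuous (V := R_CompleteNormedModule)).
  rewrite Rmin_left, Rmax_right by lra. intros t Ht.
  assert (Hr' : 0 <= r < 1) by lra.
  pose proof (A_pos r t Hr Ht) as HA. pose proof (U_pos r t Hr' Ht) as HU.
  pose proof (sum_sq_pos _ (B r t) (Rgt_not_eq _ _ HA)).
  pose proof (sum_sq_pos _ (V r t) (Rgt_not_eq _ _ HU)).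
  pose proof (is_derive_A_t r t Hr') as DA. pose proof (is_derive_B_t r t Hr') as DB.
  pose proof (is_derive_U_t r t Hr') as DU. pose proof (is_derive_V_t r t Hr') as DV.
  apply (ex_derive_continuous (V := R_NormedModule)). unfold L. auto_derive.
  repeat split; try (eexists; eassumption); lra.
Qed.

Definition K (r : R) : R := RInt (fun t => L r t) 0 (PI / 4).

(** Sine and cosine agree on this ray, so [N] is real and [h] has argument [PI / 4], which cancels
    the argument of [z]. *)
Lemma Th_PI4 (r : R) : 0 < r < 1 -> Th r (PI / 4) = 0.
Proof.
  intros Hr. pose proof (A_pos r (PI / 4) Hr ltac:(pose proof PI_RGT_0; lra)) as HA.
  unfold Th.
  replace (V r (PI / 4)) with 0 by (unfold V; rewrite sin_cos_PI4; ring).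
  replace (B r (PI / 4)) with (A r (PI / 4)) by (unfold A, B; rewrite sin_cos_PI4; ring).
  rewrite Rdiv_0_l, Rdiv_diag, atan_0, atan_1 by lra. ring.
Qed.

(** On the real axis [h] and [z] are real and contribute no argument; only that of [N] remains. *)
Lemma Th_0 (r : R) :
  Th r 0 = atan ((P r 1 - Q r 1) / (PI + P r 1 - Q r 1)).
Proof.
  assert (HP : P r 0 = 0).
  { unfold P. rewrite Rmult_0_r, Rplus_0_r, Rminus_0_r, Rdiv_diag, ln_1 by nra. ring. }
  assert (HQ : Q r 0 = 0).
  { unfold Q. rewrite Rmult_0_r, Rdiv_0_l, atan_0. ring. }
  unfold Th, A, B, U, V. rewrite cos_0, sin_0, HP, HQ, !Rminus_0_r, !Rplus_0_r, Rdiv_0_l, atan_0, !Rminus_0_r.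
  f_equal. f_equal. ring.
Qed.

(** Differentiation under the integral gives the integral of [L_r], that is of [Th_t / r]; of the
    two boundary values only the one at [t = 0] survives. *)
Lemma is_derive_K (r : R) : 0 < r < 1 -> is_derive K r (- (Th r 0 / r)).
Proof.
  intros Hr. pose proof PI_RGT_0.
  assert (Hmin : Rmin 0 (PI / 4) = 0) by (apply Rmin_left; lra).
  assert (Hmax : Rmax 0 (PI / 4) = PI / 4) by (apply Rmax_right; lra).
  assert (DL : forall x t, 0 < x < 1 -> 0 <= t <= PI / 4 -> is_derive (fun z => L z t) x (L_r x t)).
  { intros x t Hx Ht. apply is_derive_L_r; [assumption| |].
    - apply Rgt_not_eq, A_pos; assumption.
    - apply Rgt_not_eq, U_pos; lra. }
  assert (C2 : forall t, 0 <= t <= PI / 4 -> continuity_2d_pt L_r r t).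
  { intros t Ht. apply continuity_2d_L_r; [assumption| |].
    - apply Rgt_not_eq, A_pos; assumption.
    - apply Rgt_not_eq, U_pos; lra. }
  assert (HI : is_RInt (fun t => L_r r t) 0 (PI / 4) (- (Th r 0 / r))).
  { replace (- (Th r 0 / r)) with (/ r * (Th r (PI / 4) - Th r 0))
      by (rewrite Th_PI4 by assumption; field; lra).
    apply (is_RInt_ext (fun t => / r * (r * L_r r t))).
    { intros t _. change (@eq R (/ r * (r * L_r r t)) (L_r r t)). field; lra. }
    apply (is_RInt_scal (V := R_NormedModule)).
    apply (is_RInt_derive (V := R_CompleteNormedModule) (fun t => Th r t)); rewrite Hmin, Hmax; intros t Ht.
    - apply is_derive_Th_t; [assumption| |].
      + apply Rgt_not_eq, A_pos; assumption.
      + apply Rgt_not_eq, U_pos; lra.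
    - apply (continuous_scal_r (V := R_NormedModule) r), continuity_2d_pt_continuous_r, C2, Ht. }
  replace (- (Th r 0 / r)) with (RInt (fun t => Derive (fun u => L u t) r) 0 (PI / 4)).
  2:{ rewrite <- (is_RInt_unique _ _ _ _ HI). apply RInt_ext. rewrite Hmin, Hmax.
      intros t Ht. apply is_derive_unique, DL; lra. }
  apply is_derive_RInt_param; rewrite ?Hmin, ?Hmax.
  - apply (filter_imp _ _) with (2 := locally_unit_interval r Hr).
    intros x Hx t Ht. eexists. apply DL; assumption.
  - intros t Ht. apply (continuity_2d_pt_ext_loc L_r); [|now apply C2].
    (* When [t] is an endpoint of the arc, every neighbourhood of [(r, t)] leaves the sector, where
       [A_pos] and [U_pos] say nothing. Nonvanishing there comes from continuity. *)
    assert (NA : locally_2d (fun u v => A u v <> 0) r t).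
    { apply continuity_2d_pt_neq_0; [apply continuity_2d_A; lra|].
      apply Rgt_not_eq, A_pos; assumption. }
    assert (NU : locally_2d (fun u v => U u v <> 0) r t).
    { apply continuity_2d_pt_neq_0; [apply continuity_2d_U; lra|].
      apply Rgt_not_eq, U_pos; lra. }
    destruct (locally_unit_interval r Hr) as [d Hd].
    assert (N1 : locally_2d (fun u _ => 0 < u < 1) r t).
    { exists d. intros u v Hu _. apply Hd, Hu. }
    apply locally_2d_impl with (2 := NA), locally_2d_impl with (2 := NU),
      locally_2d_impl with (2 := N1), locally_2d_forall.
    intros u v Hu HU' HA'. symmetry. apply is_derive_unique, is_derive_L_r; assumption.
  - apply (filter_imp _ _) with (2 := locally_unit_interval r Hr). intros; now apply ex_RInt_L.
Qed.

(** * The limit of [K] at [0] *)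

(** Besides giving growth bounds, the case [m = M = 0] serves to prove that a function vanishes
    identically. *)
Lemma MVT_bounds (f f' : R -> R) (x m M : R) :
  0 <= x -> f 0 = 0 ->
  (forall y, 0 <= y <= x -> is_derive f y (f' y)) ->
  (forall y, 0 <= y <= x -> m <= f' y <= M) ->
  m * x <= f x <= M * x.
Proof.
  intros Hx H0 Hd Hb.
  destruct (MVT_gen f 0 x f') as [y [Hy E]]; rewrite Rmin_left, Rmax_right in * by lra.
  - intros; apply Hd; lra.
  - intros y Hy. apply continuity_pt_filterlim, (ex_derive_continuous (V := R_NormedModule)).
    eexists. apply Hd, Hy.
  - specialize (Hb y Hy). nra.
Qed.

Lemma P_at_0 (c : R) : P 0 c = 0.
Proof.
  unfold P. replace ((1 + 0 ^ 2 + 2 * 0 * c) / (1 + 0 ^ 2 - 2 * 0 * c)) with 1 by field.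
  rewrite ln_1; ring.
Qed.

Lemma Q_at_0 (c : R) : Q 0 c = 0.
Proof.
  unfold Q. replace (2 * 0 * c / (1 - 0 ^ 2)) with 0 by field.
  rewrite atan_0; ring.
Qed.

(** Common bounds on [[0, r]] for [P_r] and [Q_r] once the factor [c] is taken out; both equal [1]
    at [r = 0]. *)
Definition slope_lo (r : R) : R := (1 - r ^ 2) / (1 + r ^ 2) ^ 2.
Definition slope_hi (r : R) : R := (1 + r ^ 2) / (1 - r ^ 2) ^ 2.

Lemma slope_bounds (r x n d : R) :
  0 <= x <= r -> r < 1 -> 1 - x ^ 2 <= n <= 1 + x ^ 2 ->
  (1 - x ^ 2) ^ 2 <= d <= (1 + x ^ 2) ^ 2 -> slope_lo r <= n / d <= slope_hi r.
Proof.
  intros Hx Hr Hn Hd.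
  assert (Hxr : x ^ 2 <= r ^ 2) by (apply pow_incr; lra).
  pose proof (one_minus_sqr_pos r ltac:(lra)). pose proof (pow2_ge_0 x).
  assert (0 < (1 - r ^ 2) ^ 2) by (apply pow_lt; lra).
  assert ((1 - r ^ 2) ^ 2 <= (1 - x ^ 2) ^ 2) by (apply pow_incr; lra).
  assert ((1 + x ^ 2) ^ 2 <= (1 + r ^ 2) ^ 2) by (apply pow_incr; lra).
  unfold slope_lo, slope_hi, Rdiv. split; apply Rmult_le_compat; try lra.
  - apply Rlt_le, Rinv_0_lt_compat; lra.
  - apply Rinv_le_contravar; lra.
  - apply Rlt_le, Rinv_0_lt_compat; lra.
  - apply Rinv_le_contravar; lra.
Qed.

(** The factor [c] is kept in both bounds so that [cos^2 + sin^2 = 1] can later eliminate the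
    angle. *)
Lemma P_bounds (r c : R) :
  0 <= r < 1 -> 0 <= c <= 1 -> c * slope_lo r * r <= P r c <= c * slope_hi r * r.
Proof.
  intros Hr Hc. apply MVT_bounds with (f := fun r => P r c) (f' := fun r => P_r r c); try lra.
  - apply P_at_0.
  - intros; apply is_derive_P_r; lra.
  - intros x Hx. unfold P_r, Rdiv. rewrite Rmult_assoc.
    assert (0 <= c ^ 2 <= 1) by nra. pose proof (pow2_ge_0 x).
    enough (slope_lo r <= (1 - x ^ 2) / ((1 + x ^ 2) ^ 2 - 4 * x ^ 2 * c ^ 2) <= slope_hi r)
      by (split; apply Rmult_le_compat_l; tauto || lra).
    apply slope_bounds with x; nra.
Qed.

Lemma Q_bounds (r c : R) :
  0 <= r < 1 -> 0 <= c <= 1 -> c * slope_lo r * r <= Q r c <= c * slope_hi r * r.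
Proof.
  intros Hr Hc. apply MVT_bounds with (f := fun r => Q r c) (f' := fun r => Q_r r c); try lra.
  - apply Q_at_0.
  - intros; apply is_derive_Q_r; lra.
  - intros x Hx. unfold Q_r, Rdiv. rewrite Rmult_assoc.
    assert (0 <= c ^ 2 <= 1) by nra. pose proof (pow2_ge_0 x).
    enough (slope_lo r <= (1 + x ^ 2) / ((1 - x ^ 2) ^ 2 + 4 * x ^ 2 * c ^ 2) <= slope_hi r)
      by (split; apply Rmult_le_compat_l; tauto || lra).
    apply slope_bounds with x; nra.
Qed.

(** For small [z], [h] is close to [2 z] and [N] to [PI]. The bounds are free of [t], so they
    integrate trivially over the arc. *)
Lemma L_bounds_near_0 (r t : R) :
  0 < r <= / 4 -> 0 <= t <= PI / 4 ->
  ln (PI - 2 * r * slope_hi r) - ln (2 * slope_hi r) <= L r t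
  <= / 2 * ln ((PI + 2 * r * slope_hi r) ^ 2 + (2 * r * slope_hi r) ^ 2) - ln (2 * slope_lo r).
Proof.
  intros Hr Ht. destruct (sector_trig t Ht) as (Hc & Hs & _).
  assert (Hr1 : 0 <= r < 1) by lra.
  pose proof (P_bounds r (cos t) Hr1 ltac:(lra)) as BPc.
  pose proof (P_bounds r (sin t) Hr1 ltac:(lra)) as BPs.
  pose proof (Q_bounds r (cos t) Hr1 ltac:(lra)) as BQc.
  pose proof (Q_bounds r (sin t) Hr1 ltac:(lra)) as BQs.
  assert (Hsq : 0 < r ^ 2 <= / 16) by nra.
  assert (Hlo : 0 < slope_lo r) by (apply Rdiv_lt_0_compat; nra).
  (* The restriction [r <= / 4] gives this bound, hence [b <= / 2] below, which keeps [PI - 2 * b]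
     positive. *)
  assert (Hhi : 0 < slope_hi r <= 2).
  { split; [apply Rdiv_lt_0_compat; nra|]. apply Rle_div_l; nra. }
  pose proof PI2_3_2 as Hpi. unfold PI2 in Hpi.
  set (b := r * slope_hi r) in *.
  assert (Hb : 0 < b <= / 2) by (unfold b; nra).
  replace (cos t * slope_hi r * r) with (cos t * b) in * by (unfold b; ring).
  replace (sin t * slope_hi r * r) with (sin t * b) in * by (unfold b; ring).
  set (a := r * slope_lo r) in *.
  assert (Ha : 0 < a) by (unfold a; nra).
  replace (cos t * slope_lo r * r) with (cos t * a) in * by (unfold a; ring).
  replace (sin t * slope_lo r * r) with (sin t * a) in * by (unfold a; ring).
  replace (2 * r * slope_hi r) with (2 * b) by (unfold b; ring).
  pose proof (sin2_cos2 t) as E. unfold Rsqr in E.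
  assert (0 <= cos t * a /\ 0 <= sin t * a /\ cos t * b <= b /\ sin t * b <= b) by (repeat split; nra).
  assert (HA : 2 * (cos t * a) <= A r t <= 2 * (cos t * b)) by (unfold A; lra).
  assert (HB : 2 * (sin t * a) <= B r t <= 2 * (sin t * b)) by (unfold B; lra).
  assert (HU : PI - 2 * b <= U r t <= PI + 2 * b) by (unfold U; lra).
  assert (HV : - (2 * b) <= V r t <= 2 * b) by (unfold V; lra).
  (* The bounds on [A] and [B] are multiples of [cos t] and [sin t], so their squares add up without
     the angle. *)
  assert (HAB : (2 * a) ^ 2 <= A r t ^ 2 + B r t ^ 2 <= (2 * b) ^ 2).
  { replace ((2 * a) ^ 2) with ((2 * (cos t * a)) ^ 2 + (2 * (sin t * a)) ^ 2)
      by (transitivity ((2 * a) ^ 2 * (sin t * sin t + cos t * cos t)); [ring | rewrite E; ring]).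
    replace ((2 * b) ^ 2) with ((2 * (cos t * b)) ^ 2 + (2 * (sin t * b)) ^ 2)
      by (transitivity ((2 * b) ^ 2 * (sin t * sin t + cos t * cos t)); [ring | rewrite E; ring]).
    split; apply Rplus_le_compat; apply pow_incr; lra. }
  assert (HUV : (PI - 2 * b) ^ 2 <= U r t ^ 2 + V r t ^ 2 <= (PI + 2 * b) ^ 2 + (2 * b) ^ 2).
  { split; [|apply Rplus_le_compat; nra].
    pose proof (pow2_ge_0 (V r t)). assert ((PI - 2 * b) ^ 2 <= U r t ^ 2) by (apply pow_incr; lra). lra. }
  assert (0 < (2 * a) ^ 2) by (apply pow_lt; lra).
  assert (0 < (PI - 2 * b) ^ 2) by (apply pow_lt; lra).
  assert (H2 : forall x, 0 < x -> ln (x ^ 2) = 2 * ln x).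
  { intros x Hx. rewrite ln_pow by assumption. simpl INR. ring. }
  assert (L1 : ln ((2 * a) ^ 2) <= ln (A r t ^ 2 + B r t ^ 2)) by (apply ln_le; lra).
  assert (L2 : ln (A r t ^ 2 + B r t ^ 2) <= ln ((2 * b) ^ 2)) by (apply ln_le; lra).
  assert (L3 : ln ((PI - 2 * b) ^ 2) <= ln (U r t ^ 2 + V r t ^ 2)) by (apply ln_le; lra).
  assert (L4 : ln (U r t ^ 2 + V r t ^ 2) <= ln ((PI + 2 * b) ^ 2 + (2 * b) ^ 2)) by (apply ln_le; lra).
  rewrite H2 in L1, L2, L3 by lra.
  (* Splitting off the factor [r] produces the [ln r] that cancels the one in [L]. *)
  replace (2 * a) with (r * (2 * slope_lo r)) in L1 by (unfold a; ring).
  replace (2 * b) with (r * (2 * slope_hi r)) in L2 by (unfold b; ring).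
  rewrite ln_mult in L1, L2 by lra.
  unfold L. lra.
Qed.

Lemma K_bounds_of_L_bounds (r : R) (f g : R -> R) (If Ig : R) :
  0 < r < 1 -> is_RInt f 0 (PI / 4) If -> is_RInt g 0 (PI / 4) Ig ->
  (forall t, 0 <= t <= PI / 4 -> f t <= L r t <= g t) -> If <= K r <= Ig.
Proof.
  intros Hr Hf Hg H. pose proof PI_RGT_0.
  split.
  - apply (is_RInt_le f (fun t => L r t) 0 (PI / 4)); [lra | exact Hf | |intros; apply H; lra].
    apply (RInt_correct (V := R_CompleteNormedModule)), ex_RInt_L, Hr.
  - apply (is_RInt_le (fun t => L r t) g 0 (PI / 4)); [lra | | exact Hg | intros; apply H; lra].
    apply (RInt_correct (V := R_CompleteNormedModule)), ex_RInt_L, Hr.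
Qed.

(** The outer functions are continuous at the endpoint itself, so their limits are read off as
    values there; only [g] needs a one-sided limit. *)
Lemma filterlim_squeeze_within (D : R -> Prop) (f g h : R -> R) (x l : R) :
  within D (locally x) (fun y => f y <= g y <= h y) ->
  continuous f x -> continuous h x -> f x = l -> h x = l ->
  filterlim g (within D (locally x)) (locally l).
Proof.
  intros H Hf Hh Ef Eh.
  apply (filterlim_le_le f g h (Finite l) H).
  - rewrite <- Ef. eapply filterlim_filter_le_1; [apply filter_le_within | exact Hf].
  - rewrite <- Eh. eapply filterlim_filter_le_1; [apply filter_le_within | exact Hh].
Qed.

(** Both slopes are [1] at [0], so the bounds on [L] meet at [ln (PI / 2)], over an arc of angle
    [PI / 4]. *)
Lemma K_lim_0 : filterlim K (at_right 0) (locally (PI / 4 * (ln PI - ln 2))).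
Proof.
  pose proof PI_RGT_0.
  set (f := fun r => PI / 4 * (ln (PI - 2 * r * slope_hi r) - ln (2 * slope_hi r))).
  set (g := fun r => PI / 4 *
    (/ 2 * ln ((PI + 2 * r * slope_hi r) ^ 2 + (2 * r * slope_hi r) ^ 2)
     - ln (2 * slope_lo r))).
  apply (filterlim_squeeze_within _ f K g).
  - exists (mkposreal (/ 4) ltac:(lra)). intros r Hr Hr0.
    apply Rabs_lt_between' in Hr. simpl in Hr.
    apply (K_bounds_of_L_bounds r (fun _ => ln (PI - 2 * r * slope_hi r) - ln (2 * slope_hi r))
      (fun _ => / 2 * ln ((PI + 2 * r * slope_hi r) ^ 2 + (2 * r * slope_hi r) ^ 2) - ln (2 * slope_lo r))).
    + lra.
    + unfold f. rewrite <- (Rminus_0_r (PI / 4)) at 2. apply (is_RInt_const (V := R_NormedModule)).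
    + unfold g. rewrite <- (Rminus_0_r (PI / 4)) at 2. apply (is_RInt_const (V := R_NormedModule)).
    + intros t Ht. apply L_bounds_near_0; lra.
  - apply (ex_derive_continuous (V := R_NormedModule)). unfold f, slope_hi. auto_derive.
    rewrite ?Rmult_0_l, ?Rmult_0_r, ?Rmult_0_l, ?Ropp_0, ?Rplus_0_r, ?Rmult_1_r, ?Rinv_1,
      ?Rmult_0_l, ?Ropp_0, ?Rplus_0_r, ?Rmult_1_r.
    repeat split; lra.
  - apply (ex_derive_continuous (V := R_NormedModule)). unfold g, slope_hi, slope_lo. auto_derive.
    rewrite ?Rmult_0_l, ?Rmult_0_r, ?Rmult_0_l, ?Ropp_0, ?Rplus_0_r, ?Rmult_1_r, ?Rinv_1,
      ?Rmult_0_l, ?Ropp_0, ?Rplus_0_r, ?Rmult_1_r.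
    repeat split; try lra; nra.
  - unfold f, slope_hi. replace ((1 + 0 ^ 2) / (1 - 0 ^ 2) ^ 2) with 1 by field.
    f_equal. f_equal; f_equal; ring.
  - unfold g, slope_hi, slope_lo. replace ((1 + 0 ^ 2) / (1 - 0 ^ 2) ^ 2) with 1 by field.
    replace ((1 - 0 ^ 2) / (1 + 0 ^ 2) ^ 2) with 1 by field.
    replace ((PI + 2 * 0 * 1) ^ 2 + (2 * 0 * 1) ^ 2) with (PI ^ 2) by ring.
    rewrite ln_pow, Rmult_1_r by assumption. simpl INR. field.
Qed.

(** * The limit of [K] at [1] *)

Lemma atan_complement_le (v : R) : 0 <= v -> PI / 2 - atan v <= 2 / (1 + v).
Proof.
  intros Hv. destruct (Req_dec v 0) as [->|N].
  { rewrite atan_0. pose proof PI_4. lra. }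
  rewrite <- atan_inv by lra.
  assert (Hw : 0 < / v) by (apply Rinv_0_lt_compat; lra).
  (* With [w = / v] the claim is [atan w <= 2 w / (1 + w)]. The difference has a derivative with
     numerator [(1 - w)^2]; only the lower bound [0] is kept, and [2] is a crude upper one. *)
  destruct (MVT_bounds (fun w => 2 * w / (1 + w) - atan w)
    (fun w => (1 - w) ^ 2 / ((1 + w) ^ 2 * (1 + w ^ 2))) (/ v) 0 2) as [H _].
  - lra.
  - rewrite atan_0. field.
  - intros w Hw'. auto_derive; [lra|]. field. split; nra.
  - intros w Hw'. assert (0 < (1 + w) ^ 2 * (1 + w ^ 2)) by (apply Rmult_lt_0_compat; nra).
    split.
    + apply Rdiv_le_0_compat; [apply pow2_ge_0 | assumption].
    + apply Rle_div_l; [assumption|]. nra.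
  - replace (2 / (1 + v)) with (2 * / v / (1 + / v)) by (field; lra). lra.
Qed.

(** From [ln s <= s - 1] at [s = sqrt x]. It will show that [y * ln (1 + / y)] vanishes with [y]. *)
Lemma ln_le_2sqrt (x : R) : 0 < x -> ln x <= 2 * sqrt x.
Proof.
  intros Hx. pose proof (sqrt_lt_R0 x Hx).
  rewrite <- (sqrt_sqrt x) at 1 by lra. rewrite ln_mult by assumption.
  pose proof (exp_ineq1_le (ln (sqrt x))) as E. rewrite exp_ln in E by assumption. lra.
Qed.

(** With [c] the sine or cosine of the angle [t], the defect of [Q] from its boundary value [PI / 4]
    is small except when [t] is comparable to [1 - r^2], that is near [z = 1]. *)
Lemma Q_complement_le (r c t : R) :
  3 / 4 <= r < 1 -> 0 <= t / 2 <= c ->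
  PI / 4 - Q r c <= 2 * (1 - r ^ 2) / (2 * (1 - r ^ 2) + t).
Proof.
  intros Hr Hc. pose proof (one_minus_sqr_pos r ltac:(lra)) as Hy.
  set (y := 1 - r ^ 2) in *.
  assert (Hv : t / (2 * y) <= 2 * r * c / y).
  { apply Rle_div_l; [lra|]. replace (2 * r * c / y * (2 * y)) with (4 * (r * c)) by (field; lra). nra. }
  assert (0 <= t / (2 * y)) by (apply Rdiv_le_0_compat; lra).
  pose proof (atan_complement_le (2 * r * c / y) ltac:(lra)) as Ha.
  unfold Q. fold y.
  apply Rle_trans with (1 / (1 + 2 * r * c / y)).
  - replace (1 / (1 + 2 * r * c / y)) with (/ 2 * (2 / (1 + 2 * r * c / y))) by (field; nra). lra.
  - replace (2 * y / (2 * y + t)) with (1 / (1 + t / (2 * y))) by (field; lra).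
    unfold Rdiv at 1 3. apply Rmult_le_compat_l; [lra|]. apply Rinv_le_contravar; lra.
Qed.

(** Used at the cosine to bound [A], and hence [|h|], from below near the unit circle. *)
Lemma Q_ge_PI8 (r c : R) : 3 / 4 <= r < 1 -> / 2 <= c -> PI / 8 <= Q r c.
Proof.
  intros Hr Hc. unfold Q.
  assert (1 <= 2 * r * c / (1 - r ^ 2)).
  { apply Rle_div_r; nra. }
  assert (atan 1 <= atan (2 * r * c / (1 - r ^ 2))).
  { destruct (Req_dec 1 (2 * r * c / (1 - r ^ 2))) as [<-|N]; [lra|].
    apply Rlt_le, atan_increasing. lra. }
  rewrite atan_1 in *. lra.
Qed.

Lemma P_incr (r c d : R) : 0 <= r < 1 -> 0 <= c <= d -> d <= 1 -> P r c <= P r d.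
Proof.
  intros Hr Hc Hd. unfold P.
  pose proof (P_num_pos r c Hr ltac:(lra)). pose proof (P_den_pos r c Hr ltac:(lra)).
  pose proof (P_num_pos r d Hr ltac:(lra)). pose proof (P_den_pos r d Hr ltac:(lra)).
  apply Rmult_le_compat_l; [lra|]. apply ln_le; [apply Rdiv_lt_0_compat; assumption|].
  unfold Rdiv. apply Rmult_le_compat; [lra | apply Rlt_le, Rinv_0_lt_compat; lra | nra |].
  apply Rinv_le_contravar; nra.
Qed.

(** On the unit circle [Q = PI / 4], where [U ^ 2 + V ^ 2 = 2 (A ^ 2 + B ^ 2)]
    identically; the relative error is controlled by [PI / 4 - Q]. *)
Lemma L_bounds_near_1 (r t : R) :
  3 / 4 <= r < 1 -> 0 <= t <= PI / 4 ->
  / 2 * ln 2 + ln r <= L r t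
  <= / 2 * ln 2 + ln r + 64 * (1 - r ^ 2) / (2 * (1 - r ^ 2) + t).
Proof.
  intros Hr Ht. destruct (sector_trig t Ht) as (Hc & Hs & Hsc & Hst).
  assert (Hr1 : 0 <= r < 1) by lra.
  pose proof (one_minus_sqr_pos r Hr1) as Hy.
  pose proof (Q_complement_le r (cos t) t Hr ltac:(lra)) as Hd.
  pose proof (Q_complement_le r (sin t) t Hr ltac:(lra)) as He.
  assert (Hd0 : 0 < PI / 4 - Q r (cos t)) by (pose proof (Q_lt r (cos t)); lra).
  assert (He0 : 0 < PI / 4 - Q r (sin t)) by (pose proof (Q_lt r (sin t)); lra).
  pose proof (Q_ge_PI8 r (cos t) Hr ltac:(lra)) as Hq.
  pose proof (P_nonneg r (sin t) Hr1 Hs) as Hp.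
  pose proof (P_incr r (sin t) (cos t) Hr1 ltac:(lra) ltac:(lra)) as Hpp.
  pose proof PI2_3_2 as Hpi. unfold PI2 in Hpi.
  set (w := 2 * (1 - r ^ 2) / (2 * (1 - r ^ 2) + t)) in *.
  replace (64 * (1 - r ^ 2) / (2 * (1 - r ^ 2) + t)) with (32 * w) by (unfold w; field; lra).
  set (d := PI / 4 - Q r (cos t)) in *. set (e := PI / 4 - Q r (sin t)) in *.
  set (p := P r (cos t)) in *. set (p' := P r (sin t)) in *.
  assert (HA : (p + PI / 4) / 2 <= A r t) by (unfold A; fold p; lra).
  set (m := A r t ^ 2 + B r t ^ 2).
  assert (Hm : (p + PI / 4) ^ 2 / 4 <= m).
  { unfold m. pose proof (pow2_ge_0 (B r t)).
    replace ((p + PI / 4) ^ 2 / 4) with (((p + PI / 4) / 2) ^ 2) by field.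
    assert (((p + PI / 4) / 2) ^ 2 <= A r t ^ 2) by (apply pow_incr; lra). lra. }
  (* With [a = p + PI / 4] and [b = p' + PI / 4], [U] and [V] are the sum and difference of [a + d]
     and [b + e], while [A = a - d] and [B = b - e]. Hence [x] is the excess of [U^2 + V^2] over
     [2 * m]. *)
  set (x := 8 * ((p + PI / 4) * d + (p' + PI / 4) * e)).
  assert (EUV : U r t ^ 2 + V r t ^ 2 = 2 * m + x).
  { unfold m, x, U, V, A, B, d, e. fold p p'. field. }
  assert (Hm0 : 0 < m) by nra.
  assert (T1 : 0 <= (p + PI / 4) * d <= (p + PI / 4) * w)
    by (split; [apply Rmult_le_pos | apply Rmult_le_compat_l]; lra).
  assert (T2 : 0 <= (p' + PI / 4) * e <= (p + PI / 4) * w)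
    by (split; [apply Rmult_le_pos | apply Rmult_le_compat]; lra).
  assert (Hx0 : 0 <= x) by (unfold x; lra).
  assert (Hx : x <= 2 * m * (64 * w)).
  { apply Rle_trans with (16 * (p + PI / 4) * w); [unfold x; lra|].
    (* As [m] is at least a quarter of the square of [p + PI / 4], and [p + PI / 4 >= / 2], the
       relative error stays bounded by [w] even where [p] blows up. *)
    assert (Hs8 : p + PI / 4 <= 8 * m) by nra. assert (Hw : 0 <= w) by lra.
    pose proof (Rmult_le_compat_r w _ _ Hw Hs8). lra. }
  assert (E1 : 1 <= 1 + x / (2 * m)).
  { assert (0 <= x / (2 * m)) by (apply Rdiv_le_0_compat; lra). lra. }
  assert (E2 : x / (2 * m) <= 64 * w) by (apply Rle_div_l; lra).
  assert (EL : L r t = / 2 * ln 2 + ln r + / 2 * ln (1 + x / (2 * m))).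
  { unfold L. fold m. rewrite EUV.
    replace (2 * m + x) with (2 * m * (1 + x / (2 * m))) by (field; lra).
    rewrite !ln_mult by lra. field. }
  rewrite EL.
  assert (0 <= ln (1 + x / (2 * m))) by (rewrite <- ln_1; apply ln_le; lra).
  pose proof (exp_ineq1_le (ln (1 + x / (2 * m)))) as E. rewrite exp_ln in E by lra. lra.
Qed.

(** The error bound on [L] is not uniformly small, being [32] at [t = 0], but with [y = 1 - r^2] its
    integral over the arc is [64 y ln (1 + PI / (8 y))], which tends to [0]. *)
Lemma K_lim_1 : filterlim K (at_left 1) (locally (PI / 8 * ln 2)).
Proof.
  pose proof PI_RGT_0. pose proof PI_4.
  set (f := fun r => PI / 4 * (/ 2 * ln 2 + ln r)).
  (* The logarithmic error is singular in form at [r = 1]. It is replaced by [64 y * 2 sqrt (1 + /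
     y) = 128 sqrt (y^2 + y)], continuous there. *)
  set (g := fun r => PI / 4 * (/ 2 * ln 2 + ln r)
    + 128 * sqrt ((1 - r ^ 2) ^ 2 + (1 - r ^ 2))).
  apply (filterlim_squeeze_within _ f K g).
  - exists (mkposreal (/ 4) ltac:(lra)). intros r Hr Hr0.
    apply Rabs_lt_between' in Hr. simpl in Hr.
    pose proof (one_minus_sqr_pos r ltac:(lra)) as Hy. set (y := 1 - r ^ 2) in *.
    assert (HI : is_RInt (fun t => / 2 * ln 2 + ln r + 64 * y / (2 * y + t)) 0 (PI / 4)
      (f r + 64 * y * ln (1 + PI / 4 / (2 * y)))).
    { replace (f r + _) with
        ((/ 2 * ln 2 + ln r) * (PI / 4) + 64 * y * ln (2 * y + PI / 4)
        - ((/ 2 * ln 2 + ln r) * 0 + 64 * y * ln (2 * y + 0))).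
      2:{ replace (1 + PI / 4 / (2 * y)) with ((2 * y + PI / 4) / (2 * y)) by (field; lra).
          rewrite ln_div, Rplus_0_r by lra. unfold f. ring. }
      apply (is_RInt_derive (V := R_CompleteNormedModule)
        (fun t => (/ 2 * ln 2 + ln r) * t + 64 * y * ln (2 * y + t)));
        rewrite Rmin_left, Rmax_right by lra; intros t Ht.
      - auto_derive; [lra|]. field. lra.
      - apply (ex_derive_continuous (V := R_NormedModule)). auto_derive. lra. }
    assert (Hg : f r + 64 * y * ln (1 + PI / 4 / (2 * y)) <= g r).
    { unfold g, f. fold y. apply Rplus_le_compat_l.
      assert (Hle : ln (1 + PI / 4 / (2 * y)) <= ln (1 + / y)).
      { apply ln_le.
        - assert (0 < PI / 4 / (2 * y)) by (apply Rdiv_lt_0_compat; lra). lra.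
        - apply Rplus_le_compat_l. apply Rle_div_l; [lra|].
          replace (/ y * (2 * y)) with 2 by (field; lra). lra. }
      assert (Hy' : 0 < / y) by (apply Rinv_0_lt_compat; assumption).
      pose proof (ln_le_2sqrt (1 + / y) ltac:(lra)).
      replace (y ^ 2 + y) with (y ^ 2 * (1 + / y)) by (field; lra).
      rewrite sqrt_mult, sqrt_pow2 by (nra || lra). nra. }
    destruct (K_bounds_of_L_bounds r (fun _ => / 2 * ln 2 + ln r) _ (f r) _ ltac:(lra)
      ltac:(unfold f; rewrite <- (Rminus_0_r (PI / 4)) at 2;
            apply (is_RInt_const (V := R_NormedModule))) HI) as [H1 H2].
    + intros t Ht. apply L_bounds_near_1; lra.
    + lra.
  - apply (ex_derive_continuous (V := R_NormedModule)). unfold f. auto_derive. lra.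
  - unfold g. apply (continuous_plus (V := R_NormedModule)).
    + apply (ex_derive_continuous (V := R_NormedModule)). auto_derive. lra.
    + apply (continuous_scal_r (V := R_NormedModule) 128).
      apply (continuous_comp (fun r => (1 - r ^ 2) ^ 2 + (1 - r ^ 2)) sqrt).
      * apply (ex_derive_continuous (V := R_NormedModule)). auto_derive. exact I.
      * apply continuous_sqrt.
  - unfold f. rewrite ln_1. field.
  - unfold g. replace ((1 - 1 ^ 2) ^ 2 + (1 - 1 ^ 2)) with 0 by ring.
    rewrite ln_1, sqrt_0. field.
Qed.

(** * Closed forms on the real axis and the integral *)

(** At [c = 1] the quotient in [P] is the square of [(1 + x) / (1 - x)], so this is the usual
    logarithmic formula; [P_r] reduces to the integrand. *)
Lemma arctanh_eq_P (x : R) : 0 <= x < 1 -> arctanh x = P x 1.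
Proof.
  intros Hx. apply is_RInt_unique.
  replace (P x 1) with (P x 1 - P 0 1) by (rewrite P_at_0; ring).
  apply (is_RInt_derive (V := R_CompleteNormedModule) (fun r => P r 1));
    rewrite Rmin_left, Rmax_right by lra; intros y Hy;
    pose proof (one_minus_sqr_pos y ltac:(lra)).
  - replace (1 / (1 - y ^ 2)) with (P_r y 1); [apply is_derive_P_r; lra|].
    unfold P_r. replace ((1 + y ^ 2) ^ 2 - 4 * y ^ 2 * 1 ^ 2) with ((1 - y ^ 2) ^ 2) by ring.
    field. lra.
  - apply (ex_derive_continuous (V := R_NormedModule)). auto_derive. lra.
Qed.

(** The double-angle formula for [atan], obtained from equal derivatives and equal values at [0]. *)
Lemma atan_eq_Q (x : R) : 0 <= x < 1 -> atan x = Q x 1.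
Proof.
  intros Hx.
  destruct (MVT_bounds (fun x => atan x - Q x 1) (fun x => 0) x 0 0) as [H1 H2].
  - lra.
  - rewrite atan_0, Q_at_0. ring.
  - intros y Hy. pose proof (is_derive_Q_r y ltac:(lra) 1) as D.
    evar_last; [apply (is_derive_minus (V := R_NormedModule)); [apply is_derive_atan | exact D]|].
    unfold Q_r, minus, plus, opp, Rsqr; simpl.
    replace ((1 - y * (y * 1)) * ((1 - y * (y * 1)) * 1) + 4 * (y * (y * 1)) * (1 * (1 * 1)))
      with ((1 + y * y) ^ 2) by ring.
    field. nra.
  - intros; lra.
  - lra.
Qed.

Theorem theorem3p5 :
  is_RInt_gen
    (fun x : R =>
       atan ((arctanh x - atan x) / (PI + arctanh x - atan x)) / x)
    (at_right 0) (at_left 1)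
    (PI / 8 * ln (PI ^ 2 / 8)).
Proof.
  pose proof PI_RGT_0 as Hpi.
  (* For endpoints near [0] and [1] the whole closed segment between them lies in the open interval
     where [K] is differentiable. *)
  assert (Hnear : filter_prod (at_right 0) (at_left 1) (fun ab : R * R =>
    forall x, Rmin (fst ab) (snd ab) <= x <= Rmax (fst ab) (snd ab) -> 0 < x < 1)).
  { exists (fun a => 0 < a < 1) (fun b => 0 < b < 1).
    - exists (mkposreal 1 Rlt_0_1). intros a Ha Ha0.
      apply Rabs_lt_between' in Ha. simpl in Ha. lra.
    - exists (mkposreal 1 Rlt_0_1). intros a Ha Ha0.
      apply Rabs_lt_between' in Ha. simpl in Ha. lra.
    - intros a b Ha Hb x. simpl.
      unfold Rmin, Rmax. destruct (Rle_dec a b); lra. }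
  (* [- K] is the primitive of the integrand, written through [Th x 0]. *)
  assert (DK : forall x, 0 < x < 1 -> is_derive (fun x => - K x) x (Th x 0 / x)).
  { intros x Hx. replace (Th x 0 / x) with (opp (- (Th x 0 / x))) by apply Ropp_involutive.
    apply (is_derive_opp (V := R_NormedModule)), is_derive_K, Hx. }
  assert (CTh : forall x, 0 < x < 1 -> continuous (fun x => Th x 0 / x) x).
  { intros x Hx. assert (Hx' : 0 <= x < 1) by lra.
    pose proof (Rgt_not_eq _ _ (A_pos x 0 Hx ltac:(lra))).
    pose proof (Rgt_not_eq _ _ (U_pos x 0 Hx' ltac:(lra))).
    pose proof (is_derive_A_r x 0 Hx') as DA. pose proof (is_derive_B_r x 0 Hx') as DB.
    pose proof (is_derive_U_r x 0 Hx') as DU. pose proof (is_derive_V_r x 0 Hx') as DV.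
    apply (ex_derive_continuous (V := R_NormedModule)). unfold Th. auto_derive.
    repeat split; try (eexists; eassumption); try assumption; lra. }
  apply (is_RInt_gen_ext (Derive (fun x => - K x))).
  { apply (filter_imp _ _) with (2 := Hnear). intros [a b] Hab x Hx.
    assert (Hx1 : 0 < x < 1) by (apply Hab; lra).
    transitivity (Th x 0 / x); [apply is_derive_unique, DK, Hx1|].
    rewrite Th_0, (arctanh_eq_P x), (atan_eq_Q x) by lra. reflexivity. }
  replace (PI / 8 * ln (PI ^ 2 / 8)) with
    (* The limits of [- K] at [1] and [0] are subtracted; [8 = 2 ^ 3] reconciles the logarithms. *)
    (- (PI / 8 * ln 2) - - (PI / 4 * (ln PI - ln 2))).
  2:{ rewrite ln_div by nra. replace 8 with (2 ^ 3) at 3 by ring.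
      rewrite !ln_pow by lra. simpl INR. field. }
  apply is_RInt_gen_Derive.
  - apply (filter_imp _ _) with (2 := Hnear). intros [a b] Hab x Hx.
    eexists. apply DK, Hab, Hx.
  - apply (filter_imp _ _) with (2 := Hnear). intros [a b] Hab x Hx.
    specialize (Hab x Hx).
    apply (continuous_ext_loc _ (fun x => Th x 0 / x)); [|now apply CTh].
    apply (filter_imp _ _) with (2 := locally_unit_interval x Hab).
    intros y Hy. symmetry. apply is_derive_unique, DK, Hy.
  - apply (filterlim_comp _ _ _ K Ropp _ _ _ K_lim_0), (filterlim_opp (V := R_NormedModule)).
  - apply (filterlim_comp _ _ _ K Ropp _ _ _ K_lim_1), (filterlim_opp (V := R_NormedModule)).
Qed.
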